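(* Let $t\in[-1,1]$, let $\mathcal{B}_t$ be the set of all bivariate copulas $C$ with Blomqvist's beta $\beta(C)=t$, and let $\underline{B}_t=\inf\mathcal{B}_t$ and $\overline{B}_t=\sup\mathcal{B}_t$ be its pointwise infimum and supremum. Then Spearman's footrule satisfies (a) $\phi(\underline{B}_t)=\dfrac{3(1+t)^2}{16}-\dfrac12$, and (b) $\phi(\overline{B}_t)=1-\dfrac{3(1-t)^2}{8}$.
   Context: A bivariate copula is a function $C:[0,1]^2\to[0,1]$ with $C(u,0)=C(0,v)=0$, $C(u,1)=u$, $C(1,v)=v$, that is 2-increasing. $\mathcal{C}$ denotes the set of all bivariate copulas. Blomqvist's beta: $\beta(C)=4C\left(\tfrac12,\tfrac12\right)-1$. Concordance function: for copulas $C_1,C_2$, $\mathcal{Q}(C_1,C_2)=4\int_{[0,1]^2}C_2(u,v)\,dC_1(u,v)-1$, where $dC_1$ denotes integration with respect to the probability measure on $[0,1]^2$ with distribution function $C_1$. Spearman's footrule: $\phi(C)=\tfrac12\left(3\mathcal{Q}(C,M)-1\right)$, where $M(u,v)=\min\{u,v\}$. $\mathcal{B}_t=\{C\in\mathcal{C}:\beta(C)=t\}$; $\underline{B}_t(u,v)=\inf_{C\in\mathcal{B}_t}C(u,v)$ and $\overline{B}_t(u,v)=\sup_{C\in\mathcal{B}_t}C(u,v)$ for all $(u,v)\in[0,1]^2$. These two functions are known to be copulas. *)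

(* Defs.v *)
(* MathComp-Analysis; the reals are an arbitrary realType R. *)
From mathcomp Require Import all_boot all_order all_algebra.
From mathcomp Require Import all_classical all_reals all_analysis.

Set Implicit Arguments.
Unset Strict Implicit.
Unset Printing Implicit Defensive.

Import Order.TTheory GRing.Theory Num.Theory.

Local Open Scope classical_set_scope.
Local Open Scope ring_scope.

(* A function on [0,1]^2 is represented by a total function R -> R -> R; only
   its values on [0,1]^2 matter in what follows. *)
Record is_copula (R : realType) (C : R -> R -> R) : Prop := IsCopula {
  copula_itv : forall u v, u \in `[0, 1] -> v \in `[0, 1] -> C u v \in `[0, 1] ;
  copula_u0 : forall u, u \in `[0, 1] -> C u 0 = 0 ;
  copula_0v : forall v, v \in `[0, 1] -> C 0 v = 0 ;
  copula_u1 : forall u, u \in `[0, 1] -> C u 1 = u ;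
  copula_1v : forall v, v \in `[0, 1] -> C 1 v = v ;
  copula_2incr : forall u1 u2 v1 v2,
    u1 \in `[0, 1] -> u2 \in `[0, 1] -> v1 \in `[0, 1] -> v2 \in `[0, 1] ->
    u1 <= u2 -> v1 <= v2 ->
    0 <= C u2 v2 - C u2 v1 - C u1 v2 + C u1 v1 }.

Definition Mcop (R : realType) (u v : R) : R := Num.min u v.

Definition blomqvist_beta (R : realType) (C : R -> R -> R) : R :=
  4 * C (1 / 2) (1 / 2) - 1.

Definition unit_square (R : realType) : set (R * R) :=
  `[0, 1]%classic `*` `[0, 1]%classic.

(* Taking u = v = 1 with C 1 1 = 1 shows that such a P is concentrated on the
   unit square. *)
Definition has_cdf (R : realType) (C : R -> R -> R)
    (P : probability (R * R)%type R) : Prop :=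
  forall u v : R, u \in `[0, 1] -> v \in `[0, 1] ->
    P (`[0, u]%classic `*` `[0, v]%classic) = (C u v)%:E.

(* For a copula C, the probability with distribution function C exists and is
   unique on measurable sets; [get] returns an unspecified value when there is none. *)
Definition copula_measure (R : realType) (C : R -> R -> R) :
    probability (R * R)%type R :=
  get [set P | has_cdf C P].

Definition concordance (R : realType) (C1 C2 : R -> R -> R) : R :=
  4 * (\int[copula_measure C1]_(x in @unit_square R) C2 x.1 x.2) - 1.

Definition spearman_footrule (R : realType) (C : R -> R -> R) : R :=
  (1 / 2) * (3 * concordance C (@Mcop R) - 1).

Definition beta_class (R : realType) (t : R) : set (R -> R -> R) :=
  [set C | is_copula C /\ blomqvist_beta C = t].

Definition lowerB (R : realType) (t u v : R) : R :=
  inf [set C u v | C in beta_class t].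

Definition upperB (R : realType) (t u v : R) : R :=
  sup [set C u v | C in beta_class t].

(* Main.v *)
(** The extremal functions are explicit: with [d = (1 + t) / 4 = C (1/2, 1/2)],
    monotonicity and the Lipschitz property of copulas confine every copula of
    the class between
      [max (0, u + v - 1, d - (1/2 - u)^+ - (1/2 - v)^+)] and
      [min (u, v, d + (u - 1/2)^+ + (v - 1/2)^+)].
    Both bounds are copulas, being the distribution functions of shuffles of Min:
    the law of [(x, s x)], resp. [(x, 1 - s x)], for [x] uniform on [[0, 1]] and
    [s] a piecewise translation.  Finally, by the layer-cake formula, a measure
    with distribution function [C] satisfies
      [int min (x, y) dC = int_0^1 C-mass of {x > r, y > r} dr
                         = int_0^1 (1 - 2 r + C (r, r)) dr],
    so that the footrule only depends on the diagonal of [C], which is piecewise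
    affine for both bounds. *)
Require Import Defs.
From mathcomp Require Import all_boot all_order all_algebra.
From mathcomp Require Import all_classical all_reals all_analysis.
From mathcomp Require Import measurable_realfun lra.

Set Implicit Arguments.
Unset Strict Implicit.

Import Order.TTheory GRing.Theory Num.Theory.
Import numFieldNormedType.Exports.
Local Open Scope classical_set_scope.
Local Open Scope ring_scope.

(** * Sums of truncated affine functions *)

Ltac atomic_minmax e :=
  lazymatch e with
  | context [Num.max _ _] => fail
  | context [Num.min _ _] => fail
  | _ => idtac
  end.

(** Innermost minima and maxima are eliminated first, which is what [atomic_minmax] tests. A case
    split happens only when [lra] cannot decide the comparison, so few branches arise. *)
Ltac minmax_lra :=
  repeat match goal with
  | |- context [Num.max ?a ?b] =>
    atomic_minmax a; atomic_minmax b;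
    first [rewrite (@max_l _ _ a b); [|lra] | rewrite (@max_r _ _ a b); [|lra]
          | case: (leP a b) => ?]
  | |- context [Num.min ?a ?b] =>
    atomic_minmax a; atomic_minmax b;
    first [rewrite (@min_l _ _ a b); [|lra] | rewrite (@min_r _ _ a b); [|lra]
          | case: (leP a b) => ?]
  end; lra.

Section Clamp.
Context {R : realFieldType}.
Implicit Types a b d u v x y : R.

(** This is the length of the part of []a, b[] to the left of [x]. *)
Definition clamp a b x : R := Num.max 0 (Num.min b x - a).

Lemma clamp_min a b x y :
  clamp a b (Num.min x y) = Num.min (clamp a b x) (clamp a b y).
Proof. by rewrite /clamp; have [?|?] := leP x y; minmax_lra. Qed.

Lemma clampB a b x c : clamp a b (x - c) = clamp (a + c) (b + c) x.
Proof. by rewrite /clamp; minmax_lra. Qed.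

Lemma clamp_id a b x : a <= b -> b <= x -> clamp a b x = b - a.
Proof. by move=> ab bx; rewrite /clamp min_l // max_r // subr_ge0. Qed.

Lemma clamp_mid a b x : a <= x -> x <= b -> clamp a b x = x - a.
Proof. by move=> ax xb; rewrite /clamp min_r // max_r // subr_ge0. Qed.

Lemma clamp0 a b x : x <= a -> clamp a b x = 0.
Proof. by move=> xa; rewrite /clamp max_l // subr_le0 ge_min xa orbT. Qed.

(** The breakpoints [d], [1 / 2] and [1 - d] give four positions of [u], in each of which all four
    lengths are affine in [u]. *)
Lemma clampP d u : 0 <= d <= 1 / 2 -> 0 <= u <= 1 ->
  let P c1 c2 c3 c4 := clamp 0 d u = c1 /\ clamp d (1 / 2) u = c2 /\
    clamp (1 / 2) (1 - d) u = c3 /\ clamp (1 - d) 1 u = c4 in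
  [\/ u <= d /\ P u 0 0 0,
   d <= u <= 1 / 2 /\ P d (u - d) 0 0,
   1 / 2 <= u <= 1 - d /\ P d (1 / 2 - d) (u - 1 / 2) 0 |
   1 - d <= u /\ P d (1 / 2 - d) (1 / 2 - d) (u - (1 - d))].
Proof.
move=> /andP[d0 d1] /andP[u0 u1] P; rewrite {}/P.
have [ud|/ltW du] := leP u d.
  by apply: Or41; rewrite clamp_mid ?clamp0 ?subr0 //; lra.
have [uh|/ltW hu] := leP u (1 / 2).
  apply: Or42; rewrite du (clamp_id d0) // (@clamp_mid d) // !clamp0 ?subr0 //; lra.
have [ud|/ltW du'] := leP u (1 - d).
  apply: Or43; rewrite hu (clamp_id d0) // (clamp_id d1) //.
  rewrite (@clamp_mid (1 / 2)) // clamp0 ?subr0 //; lra.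
have hd : 1 / 2 <= 1 - d by lra.
apply: Or44; rewrite du' (clamp_id d0) // (clamp_id d1) // (clamp_id hd) //.
by rewrite (@clamp_mid (1 - d)) // subr0; do !split; lra.
Qed.

(* The summands are the lengths of [{x | x <= u, shuffle d x <= v}] on the four
   pieces of the shuffle. *)
Lemma clamp_sum d u v : 0 <= d <= 1 / 2 -> 0 <= u <= 1 -> 0 <= v <= 1 ->
  clamp 0 d (Num.min u v)
  + clamp d (1 / 2) (Num.min u (v - (1 / 2 - d)))
  + clamp (1 / 2) (1 - d) (Num.min u (v + (1 / 2 - d)))
  + clamp (1 - d) 1 (Num.min u v)
  = Num.min (Num.min u v) (d + Num.max 0 (u - 1 / 2) + Num.max 0 (v - 1 / 2)).
Proof.
move=> dh u01 v01.
(* Both shifts are written as subtractions so that [clampB] applies. It exchanges the two middle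
   intervals in the constraints on [v], and every term becomes a minimum of two of the lengths in
   [clampP]. *)
have -> : v + (1 / 2 - d) = v - (d - 1 / 2) by lra.
rewrite !clamp_min !clampB.
have -> : d + (1 / 2 - d) = 1 / 2 by lra.
have -> : 1 / 2 + (1 / 2 - d) = 1 - d by lra.
have -> : 1 / 2 + (d - 1 / 2) = d by lra.
have -> : 1 - d + (d - 1 / 2) = 1 / 2 by lra.
have := clampP dh u01; have := clampP dh v01.
by case=> -[? [-> [-> [-> ->]]]]; case=> -[? [-> [-> [-> ->]]]];
  rewrite ?minxx; minmax_lra.
Qed.

End Clamp.

(** * Bounds on copulas with prescribed central value *)

Section CopulaBounds.
Context {R : realType} {C : R -> R -> R}.
Context (copC : is_copula C).

(** The lower bound is the nonnegative mass of [[u, u'] x [0, v]], and the upper bound that of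
    [[u, u'] x [v, 1]]. *)
Lemma copula_incr1 u u' v : 0 <= u -> u <= u' -> u' <= 1 -> 0 <= v <= 1 ->
  0 <= C u' v - C u v <= u' - u.
Proof.
move=> u0 uu' u1 /andP[v0 v1].
have [I0 I1] : (0 : R) \in `[0, 1] /\ (1 : R) \in `[0, 1].
  by rewrite !in_itv /= !lexx !ler01.
have Iu : u \in `[0, 1] by rewrite in_itv /= u0 (le_trans uu').
have Iu' : u' \in `[0, 1] by rewrite in_itv /= u1 (le_trans u0).
have Iv : v \in `[0, 1] by rewrite in_itv /= v0.
have := copula_2incr copC Iu Iu' I0 Iv uu' v0.
have := copula_2incr copC Iu Iu' Iv I1 uu' v1.
rewrite !(copula_u0 copC) // !(copula_u1 copC) //; lra.
Qed.

Lemma copula_incr2 u v v' : 0 <= v -> v <= v' -> v' <= 1 -> 0 <= u <= 1 ->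
  0 <= C u v' - C u v <= v' - v.
Proof.
move=> v0 vv' v1 /andP[u0 u1].
have [I0 I1] : (0 : R) \in `[0, 1] /\ (1 : R) \in `[0, 1].
  by rewrite !in_itv /= !lexx !ler01.
have Iv : v \in `[0, 1] by rewrite in_itv /= v0 (le_trans vv').
have Iv' : v' \in `[0, 1] by rewrite in_itv /= v1 (le_trans v0).
have Iu : u \in `[0, 1] by rewrite in_itv /= u0.
have := copula_2incr copC I0 Iu Iv Iv' u0 vv'.
have := copula_2incr copC Iu I1 Iv Iv' u1 vv'.
rewrite !(copula_0v copC) // !(copula_1v copC) //; lra.
Qed.

End CopulaBounds.

Section ExtremalCopulas.
Context {R : realType}.
Implicit Types (d u v x : R) (C : R -> R -> R).

Definition lower_cop d u v : R :=
  Num.max (Num.max 0 (u + v - 1))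
    (d - Num.max 0 (1 / 2 - u) - Num.max 0 (1 / 2 - v)).

Definition upper_cop d u v : R :=
  Num.min (Num.min u v) (d + Num.max 0 (u - 1 / 2) + Num.max 0 (v - 1 / 2)).

(** The bounds free of the central value come from comparison with the sides of the square. The
    others come from moving [(u, v)] horizontally to the line [u = 1 / 2] and then vertically to the
    centre. *)
Lemma copula_between C u v : is_copula C -> 0 <= u <= 1 -> 0 <= v <= 1 ->
  lower_cop (C (1 / 2) (1 / 2)) u v <= C u v <= upper_cop (C (1 / 2) (1 / 2)) u v.
Proof.
move=> copC u01 v01; have [/andP[u0 u1] /andP[v0 v1]] := (u01, v01).
have h01 : 0 <= (1 / 2 : R) <= 1 by lra.
have [h0 h1] := andP h01.
have [I0 I1] : (0 : R) \in `[0, 1] /\ (1 : R) \in `[0, 1].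
  by rewrite !in_itv /= !lexx !ler01.
have Iu : u \in `[0, 1] by rewrite in_itv.
have Iv : v \in `[0, 1] by rewrite in_itv.
have := copula_incr1 copC (lexx 0) u0 u1 v01.
have := copula_incr1 copC u0 u1 (lexx 1) v01.
have := copula_incr2 copC (lexx 0) v0 v1 u01.
rewrite (copula_u0 copC) // (copula_0v copC) // (copula_1v copC) //.
rewrite /lower_cop /upper_cop => c1 c2 c3.
(* The quadrant of [(u, v)] around the centre fixes the direction of both moves and the value of
   each positive part. *)
have [hu|/ltW hu] := leP u (1 / 2); have [hv|/ltW hv] := leP v (1 / 2).
- have := copula_incr1 copC u0 hu h1 v01.
  have := copula_incr2 copC v0 hv h1 h01.
  rewrite [Num.max 0 (1 / 2 - u)]max_r ?[Num.max 0 (1 / 2 - v)]max_r; try lra.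
  rewrite [Num.max 0 (u - 1 / 2)]max_l ?[Num.max 0 (v - 1 / 2)]max_l; try lra.
  rewrite !ge_max !le_min; lra.
- have := copula_incr1 copC u0 hu h1 v01.
  have := copula_incr2 copC h0 hv v1 h01.
  rewrite [Num.max 0 (1 / 2 - u)]max_r ?[Num.max 0 (1 / 2 - v)]max_l; try lra.
  rewrite [Num.max 0 (u - 1 / 2)]max_l ?[Num.max 0 (v - 1 / 2)]max_r; try lra.
  rewrite !ge_max !le_min; lra.
- have := copula_incr1 copC h0 hu u1 v01.
  have := copula_incr2 copC v0 hv h1 h01.
  rewrite [Num.max 0 (1 / 2 - u)]max_l ?[Num.max 0 (1 / 2 - v)]max_r; try lra.
  rewrite [Num.max 0 (u - 1 / 2)]max_r ?[Num.max 0 (v - 1 / 2)]max_l; try lra.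
  rewrite !ge_max !le_min; lra.
- have := copula_incr1 copC h0 hu u1 v01.
  have := copula_incr2 copC h0 hv v1 h01.
  rewrite [Num.max 0 (1 / 2 - u)]max_l ?[Num.max 0 (1 / 2 - v)]max_l; try lra.
  rewrite [Num.max 0 (u - 1 / 2)]max_r ?[Num.max 0 (v - 1 / 2)]max_r; try lra.
  rewrite !ge_max !le_min; lra.
Qed.

End ExtremalCopulas.

(** * Lebesgue measure and integral of piecewise affine data *)

Section LebesguePieces.
Context {R : realType}.
Implicit Types (a b c q : R) (S : set R).
Let mu := @lebesgue_measure R.

(** Only the null point [b] is lost. Open pieces make the values of a shuffle at its breakpoints
    irrelevant. *)
Lemma lebesgue_cut a b c S : measurable S -> a <= b -> b <= c ->
  (mu (S `&` `]a, c[) = mu (S `&` `]a, b[) + mu (S `&` `]b, c[))%E.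
Proof.
move=> mS ab bc.
have mSi (i : interval R) : measurable (S `&` [set` i]).
  by apply: measurableI => //; exact: measurable_itv.
rewrite -(measureU mu (mSi _) (mSi _)); last first.
  rewrite -subset0 => x [[_ /= xb] [_ /= bx]].
  by move: xb bx; rewrite !in_itv /= => *; exfalso; lra.
apply/eqP; rewrite eq_le; apply/andP; split; last first.
  apply: le_measure; rewrite ?inE; [by apply: measurableU; exact: mSi|exact: mSi|].
  by move=> x /= [] [Sx]; rewrite in_itv /= => h; split; rewrite // in_itv /=; lra.
(* The zero added on the right is the measure of the missing singleton, so subadditivity gives this
   inequality. *)
rewrite -[leRHS]adde0 -(lebesgue_measure_set1 b).
have mU : measurable (S `&` `]a, b[ `|` S `&` `]b, c[).
  by apply: measurableU; exact: mSi.
apply: le_trans (measureU2 mu mU (measurable_set1 b)).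
apply: le_measure; rewrite ?inE; [exact: mSi|exact: measurableU|].
move=> x /= [Sx]; rewrite in_itv /= => /andP[ax xc].
have [xb|xb|->] := ltgtP x b; last by right.
- by left; left; split; rewrite // in_itv /= ax.
- by left; right; split; rewrite // in_itv /= xb.
Qed.

(** With [m = Num.min b q], the set is squeezed between []a, m[] and []a, m]], which have the same
    length. Membership of [q] itself is left open, so strict and weak constraints are covered
    alike. *)
Lemma lebesgue_initial_segment a b q S : measurable S ->
  (forall x, a < x < b -> x < q -> S x) ->
  (forall x, a < x < b -> S x -> x <= q) ->
  mu (S `&` `]a, b[) = (Num.max 0 (Num.min b q - a))%:E.
Proof.
move=> mS qS Sq; set m := Num.min b q.
have mSi : measurable (S `&` `]a, b[).
  by apply: measurableI => //; exact: measurable_itv.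
have len (i : interval R) :
    i = Interval (BRight a) (BLeft m) \/ i = Interval (BRight a) (BRight m) ->
    mu [set` i] = (Num.max 0 (m - a))%:E.
  by case=> ->; rewrite /mu lebesgue_measure_itv /= lte_fin;
    (case: ltP => [/ltW am|am];
      [rewrite -EFinB max_r ?subr_ge0|rewrite max_l ?subr_le0]).
apply/eqP; rewrite eq_le; apply/andP; split.
- rewrite -(len _ (or_intror erefl)); apply: le_measure; rewrite ?inE //.
  move=> x [Sx /=]; rewrite !in_itv /= => axb.
  by rewrite /m le_min (Sq x) //; lra.
- rewrite -(len _ (or_introl erefl)); apply: le_measure; rewrite ?inE //.
  move=> x /=; rewrite in_itv /= /m lt_min => /and3P[ax xb xq].
  have axb : a < x < b by rewrite ax.
  by split; [exact: qS|rewrite /= in_itv].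
Qed.

(** The density equals one on the closed interval, and the two endpoints are null. The open interval
    is the form that [lebesgue_cut] splits. *)
Lemma uniform01E S : measurable S ->
  uniform_prob (@ltr01 R) S = mu (S `&` `]0, 1[).
Proof.
move=> mS; rewrite /uniform_prob integral_uniform_pdf.
rewrite (eq_integral (fun=> 1%:E)); last first.
  move=> x; rewrite inE => -[_ /=]; rewrite in_itv /= /uniform_pdf => ->.
  by rewrite subr0 invr1.
rewrite integral_cst /=; last exact: measurableI.
rewrite mul1e; apply/eqP; rewrite eq_le; apply/andP; split; last first.
  apply: le_measure; rewrite ?inE; try exact: measurableI.
  by move=> x [Sx] /=; rewrite in_itv /= => h; split; rewrite //= in_itv /=; lra.
have m2 : measurable ([set 0; 1] : set R) by exact: measurableU.
have m3 : measurable (S `&` `]0, 1[).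
  by apply: measurableI => //; exact: measurable_itv.
apply: (@le_trans _ _ (mu ((S `&` `]0, 1[) `|` [set 0; 1]))).
  apply: le_measure; rewrite ?inE; [exact: measurableI|exact: measurableU|].
  move=> x [Sx] /=; rewrite in_itv /= => /andP[x0 x1].
  have [->|x0'] := eqVneq x 0; first by right; left.
  have [->|x1'] := eqVneq x 1; first by right; right.
  by left; split; rewrite //= in_itv /= lt_def x0' x0 lt_neqAle x1' x1.
apply: le_trans (measureU2 mu m3 m2) _.
rewrite -[leRHS]adde0 leeD2l //.
apply: le_trans (measureU2 mu (measurable_set1 0) (measurable_set1 1)) _.
by rewrite [X in (X + _)%E](lebesgue_measure_set1 0)
  [X in (_ + X)%E](lebesgue_measure_set1 1) adde0.
Qed.

End LebesguePieces.

(** * Integrals of piecewise affine functions *)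

Section PiecewiseAffine.
Context {R : realType}.
Implicit Types (a b c p q : R) (f : R -> R).
Let mu : {measure set _ -> \bar R} := @lebesgue_measure R.

Lemma integral_affine a b p q f : a <= b ->
  (forall x, a <= x <= b -> f x = p * x + q) ->
  (\int[mu]_(x in `[a, b]) (f x)%:E =
   (p * (b ^+ 2 - a ^+ 2) / 2 + q * (b - a))%:E)%E.
Proof.
(* Degenerate intervals do occur, since breakpoints of the diagonal merge for extreme values of [d];
   the fundamental theorem of calculus covers only [a < b]. *)
move=> ab fE; move: ab; rewrite le_eqVlt => /predU1P[<-|ab].
  by rewrite set_itv1 integral_set1 !subrr !mulr0 mul0r addr0.
transitivity (\int[mu]_(x in `[a, b]) (p * x + q)%:E)%E.
  by apply: eq_integral => x; rewrite inE /= in_itv /= => /fE ->.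
pose F x : R := p / 2 * (x * x) + q * x.
have dF (x : R) : is_derive x 1 F (p * x + q).
  rewrite /F; apply: is_derive_eq; rewrite !scaler1.
  by rewrite /GRing.scale /=; lra.
rewrite (@continuous_FTC2 _ _ F) //.
- by rewrite -EFinB /F; congr EFin; lra.
- apply: derivable_within_continuous => x _; exact: ex_derive.
- have cF (x : R) : {for x, continuous F}.
    by apply/differentiable_continuous; rewrite -derivable1_diffP.
  split; first by move=> x _; apply: ex_derive.
  + by apply: cvg_at_right_filter; exact: cF.
  + by apply: cvg_at_left_filter; exact: cF.
- by move=> x _; rewrite derive1E; exact: derive_val.
Qed.

Lemma ge0_integral_cut a b c f : measurable_fun setT f ->
  (forall x, a <= x <= c -> 0 <= f x) -> a <= b -> b <= c ->
  (\int[mu]_(x in `[a, c]) (f x)%:E =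
   \int[mu]_(x in `[a, b]) (f x)%:E + \int[mu]_(x in `[b, c]) (f x)%:E)%E.
Proof.
move=> mf f0 ab bc.
have mEf D : measurable_fun D (EFin \o f).
  by apply/measurable_EFinP; apply: measurable_funTS.
(* Opening the second interval at [b] leaves its integral unchanged and makes the two pieces
   disjoint. *)
rewrite -(@integral_itv_obnd_cbnd _ b) //.
rewrite -ge0_integral_setU //=.
- by rewrite -itv_bndbnd_setU ?bnd_simp.
- exact: mEf.
- move=> x /= h; rewrite lee_fin f0 //; move: h; rewrite !in_itv /=; lra.
- by apply/disj_setPS => x [] /=; rewrite !in_itv /= => *; exfalso; lra.
Qed.

End PiecewiseAffine.

(** * Distribution functions and concordance with Min *)

Lemma measureDS_fin d (T : measurableType d) (R : realType)
    (P : probability T R) (A B : set T) (a b : R) :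
  measurable A -> measurable B -> A `<=` B ->
  P A = a%:E -> P B = b%:E -> P (B `\` A) = (b - a)%:E.
Proof.
move=> mA mB AB PA PB.
have -> : (P (B `\` A) = P B - P A)%E.
  rewrite -{2}(setIidr AB); apply: measureD => //.
  by apply: (le_lt_trans (y := b%:E)); rewrite ?ltry // -PB.
by rewrite PA PB.
Qed.

Section DistributionFunction.
Context {R : realType} {C : R -> R -> R} {P : probability (R * R)%type R}.
Context (cdfP : has_cdf C P).
Implicit Types u v : R.

Lemma cdf_strip u1 u2 v : u1 \in `[0, 1] -> u2 \in `[0, 1] -> v \in `[0, 1] ->
  u1 <= u2 -> P (`]u1, u2] `*` `[0, v]) = (C u2 v - C u1 v)%:E.
Proof.
move=> Iu1 Iu2 Iv u12.
have -> : `]u1, u2] `*` `[0, v] =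
    (`[0, u2] `*` `[0, v]) `\` (`[0, u1] `*` `[0, v]).
  have := Iu1; rewrite in_itv /= => Iu1'.
  apply/seteqP; split=> -[x y] /=; rewrite !in_itv /=.
    by move=> [/andP[ux xu] yv]; split=> [|[]]; [split=> //|]; lra.
  by move=> [[/andP[x0 xu] yv]] nx; split=> //; rewrite xu andbT ltNge;
    apply/negP => xu1; apply: nx; rewrite x0 xu1.
apply: measureDS_fin; rewrite ?cdfP //; try exact: measurableX.
by move=> [x y] /=; rewrite !in_itv /= => -[/andP[? ?] ?]; split=> //; lra.
Qed.

(** A second difference, now in the other coordinate, of the strip formula. Half-open sides make
    these set differences exact. *)
Lemma cdf_rectangle u1 u2 v1 v2 :
  u1 \in `[0, 1] -> u2 \in `[0, 1] -> v1 \in `[0, 1] -> v2 \in `[0, 1] ->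
  u1 <= u2 -> v1 <= v2 ->
  P (`]u1, u2] `*` `]v1, v2]) = (C u2 v2 - C u2 v1 - C u1 v2 + C u1 v1)%:E.
Proof.
move=> Iu1 Iu2 Iv1 Iv2 u12 v12.
have -> : `]u1, u2] `*` `]v1, v2] =
    (`]u1, u2] `*` `[0, v2]) `\` (`]u1, u2] `*` `[0, v1]).
  have := Iv1; rewrite in_itv /= => Iv1'.
  apply/seteqP; split=> -[x y] /=; rewrite !in_itv /=.
    by move=> [xu /andP[vy yv]]; split=> [|[]]; [split=> //|]; lra.
  by move=> [[xu /andP[y0 yv]]] ny; split=> //; rewrite yv andbT ltNge;
    apply/negP => yv1; apply: ny; rewrite y0 yv1.
have -> : C u2 v2 - C u2 v1 - C u1 v2 + C u1 v1 =
    (C u2 v2 - C u1 v2) - (C u2 v1 - C u1 v1) by lra.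
apply: measureDS_fin.
- exact: measurableX.
- exact: measurableX.
- by move=> [x y] /=; rewrite !in_itv /= => -[? /andP[? ?]]; split=> //; lra.
- exact: cdf_strip.
- exact: cdf_strip.
Qed.

(** The range and the 2-increasing property express that [P] takes values between 0 and 1, so an
    explicit distribution function needs only its boundary values checked. *)
Lemma cdf_copula :
  (forall u, u \in `[0, 1] -> [/\ C u 0 = 0, C 0 u = 0, C u 1 = u & C 1 u = u]) ->
  is_copula C.
Proof.
move=> bndC; split=> [u v Iu Iv|u /bndC[]|u /bndC[]|u /bndC[]|u /bndC[]|] //.
  have P0 : (0 <= P (`[0%R, u] `*` `[0%R, v]))%E by exact: measure_ge0.
  have P1 : (P (`[0%R, u] `*` `[0%R, v]) <= 1)%E.
    by apply: probability_le1; exact: measurableX.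
  by move: P0 P1; rewrite cdfP // !lee_fin in_itv /= => -> ->.
move=> u1 u2 v1 v2 Iu1 Iu2 Iv1 Iv2 u12 v12.
by rewrite -lee_fin -cdf_rectangle.
Qed.

End DistributionFunction.

Lemma ge0_integral_ccdf d (T : measurableType d) (R : realType)
    (P : probability T R) (f : T -> R) :
  measurable_fun setT f -> (forall x, 0 <= f x) ->
  (\int[P]_x (f x)%:E =
   \int[lebesgue_measure]_(r in `[0%R, +oo[) P (f @^-1` `]r, +oo[))%E.
Proof.
move=> mf f0; pose X : {RV P >-> R} := mfun_Sub (mem_set mf).
by have := @ge0_expectation_ccdf _ _ _ P X f0; rewrite expectation_def.
Qed.

Lemma concordance_Mcop (R : realType) (C : R -> R -> R)
    (P : probability (R * R)%type R) :
  is_copula C -> has_cdf C P ->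
  concordance C (@Mcop R) =
  4 * \int[lebesgue_measure]_(r in `[0, 1]) (1 - 2 * r + C r r) - 1.
Proof.
move=> copC cdfP; rewrite /concordance; congr (4 * _ - 1).
(* The given [P] serves only to show that [get] does not fall back on its default; the measure it
   selects takes over the name. *)
have {P cdfP} : has_cdf C (copula_measure C) by apply: getPex; exists P.
move: (copula_measure C) => P cdfP.
(* Extension by zero outside the square gives a nonnegative function on the plane, as the layer-cake
   formula requires. *)
pose X := (fun p : R * R => Mcop p.1 p.2) \_ (@unit_square R).
have mD : measurable (@unit_square R) by exact: measurableX.
have mX : measurable_fun setT X.
  apply/(measurable_restrictT _ mD); apply: measurable_funTS.
  exact: measurable_minr.
have X0 p : 0 <= X p.
  rewrite /X patchE; case: ifPn => // /set_mem[] /=.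
  by rewrite !in_itv /= /Mcop le_min; lra.
rewrite Rintegral_mkcond -/X {1}/Rintegral ge0_integral_ccdf //; congr fine.
(* Both sides become integrals over [[0, +oo[], to be compared pointwise in [r]. *)
have <- : `[0, +oo[%classic `&` `[0, 1]%classic = `[0, 1]%classic :> set R.
  by apply/seteqP; split=> x /=; rewrite !in_itv /= ?andbT; [case|]; lra.
rewrite integral_mkcondr; apply: eq_integral => r.
rewrite inE /= in_itv /= andbT => r0; rewrite patchE.
have preX : X @^-1` `]r, +oo[ = `]r, 1] `*` `]r, 1].
  apply/seteqP; split=> -[x y] /=; rewrite !in_itv /= ?andbT /X patchE.
    case: ifPn => [/set_mem[] /=|_]; last first.
      (* Outside the square the restriction takes the default value [point], which is 0 and does not
         exceed [r]. *)
      by rewrite -[point]/(0 : R) => ?; exfalso; lra.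
    rewrite !in_itv /= /Mcop lt_min => ? ? /andP[? ?]; lra.
  move=> [? ?]; rewrite mem_set /=; last by split; rewrite /= in_itv /=; lra.
  by rewrite /Mcop lt_min; lra.
rewrite preX; case: ifPn => [/set_mem /=|].
  rewrite in_itv /= => /andP[_ r1].
  have I1 : (1 : R) \in `[0, 1] by rewrite in_itv /= lexx ler01.
  have Ir : r \in `[0, 1] by rewrite in_itv /= r0.
  rewrite (cdf_rectangle cdfP) // !(copula_u1 copC) // (copula_1v copC) //.
  by congr EFin; lra.
(* For [r > 1] the rectangle is empty, matching the zero on the other side. *)
rewrite notin_setE /= in_itv /= r0 /= => /negP; rewrite -ltNge => r1.
by rewrite set_itv_ge ?set0X ?measure0 // bnd_simp -leNgt ltW.
Qed.

(** * The extremal copulas as shuffles of Min *)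

Section Shuffle.
Context {R : realType}.
Implicit Types d u v x : R.

(** The two middle intervals, each of length [1 / 2 - d], are exchanged and the outer two are fixed.
    Among [0 <= x <= 1 / 2], exactly the points with [x <= d] have image at most [1 / 2], which
    gives central value [d]. *)
Definition shuffle d x : R :=
  if x <= d then x else if x <= 1 / 2 then x + (1 / 2 - d)
  else if x <= 1 - d then x - (1 / 2 - d) else x.

Lemma measurable_shuffle d : measurable_fun setT (shuffle d).
Proof.
have mle (a : R) : measurable_fun setT (fun x : R => x <= a).
  exact: measurable_fun_ler.
apply: measurable_fun_ifT; [exact: mle|exact: measurable_id|].
apply: measurable_fun_ifT; [exact: mle|exact: measurable_funD|].
by apply: measurable_fun_ifT; [exact: mle|exact: measurable_funB|].
Qed.

Lemma shuffle_affine d x : 0 <= d <= 1 / 2 ->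
  [/\ x <= d -> shuffle d x = x,
      d < x <= 1 / 2 -> shuffle d x = x + (1 / 2 - d),
      1 / 2 < x <= 1 - d -> shuffle d x = x - (1 / 2 - d) &
      1 - d < x -> shuffle d x = x].
Proof.
move=> d01; rewrite /shuffle.
by have [xd|xd] := leP x d; have [xh|xh] := leP x (1 / 2);
  have [xd'|xd'] := leP x (1 - d); split=> // *; exfalso; lra.
Qed.

Lemma shuffle01 d x : 0 <= d <= 1 / 2 -> 0 < x < 1 -> 0 <= shuffle d x <= 1.
Proof.
move=> d01 x01; rewrite /shuffle.
by case: (leP x d) => ?; [|case: (leP x (1 / 2)) => ?;
  [|case: (leP x (1 - d)) => ?]]; lra.
Qed.

(** The left side is the copula of [(X, 1 - Y)] when [(X, Y)] has copula [upper_cop (1 / 2 - d)]; at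
    the centre it equals [1 / 2 - (1 / 2 - d) = d]. *)
Lemma lower_upper_cop d u v : 0 <= d <= 1 / 2 -> 0 <= u <= 1 -> 0 <= v <= 1 ->
  u - upper_cop (1 / 2 - d) u (1 - v) = lower_cop d u v.
Proof.
move=> d01 u01 v01; rewrite /upper_cop /lower_cop.
by case: (leP u (1 / 2)) => ?; case: (leP v (1 / 2)) => ?; minmax_lra.
Qed.

(** Between the strict and the weak constraints [S] is free, which serves both the closed rectangles
    of the upper copula and the half-strict set used for the lower one. *)
Lemma shuffle_length d u v (S : set R) :
  0 <= d <= 1 / 2 -> 0 <= u <= 1 -> 0 <= v <= 1 -> measurable S ->
  (forall x, 0 < x < 1 -> x < u -> shuffle d x < v -> S x) ->
  (forall x, 0 < x < 1 -> S x -> x <= u /\ shuffle d x <= v) ->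
  uniform_prob (@ltr01 R) S = (upper_cop d u v)%:E.
Proof.
move=> d01 u01 v01 mS loS upS; rewrite uniform01E //.
have [d0 d1] := andP d01.
have [h0 h1] : (0 : R) <= 1 / 2 /\ (1 / 2 : R) <= 1 by split; lra.
have [h2 h3] : 1 / 2 <= 1 - d /\ 1 - d <= 1 by split; lra.
(* On each of the four pieces the shuffle is a translation, so [S] is there an initial segment
   ending at the minimum of [u] and [v] less the shift. *)
rewrite (lebesgue_cut mS h0 h1) (lebesgue_cut mS d0 d1) (lebesgue_cut mS h2 h3).
rewrite (@lebesgue_initial_segment _ 0%R d (Num.min u v)) //; last 2 first.
- move=> x xab; have [E1 E2 E3 E4] := shuffle_affine x d01.
  by rewrite lt_min => /andP[xu xv]; apply: loS; rewrite ?E1; lra.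
- move=> x xab; have [E1 E2 E3 E4] := shuffle_affine x d01.
  by move=> /upS[|xu]; rewrite ?E1 ?le_min; lra.
rewrite (@lebesgue_initial_segment _ d (1 / 2)%R
  (Num.min u (v - (1 / 2 - d)))%R) //; last 2 first.
- move=> x xab; have [E1 E2 E3 E4] := shuffle_affine x d01.
  by rewrite lt_min => /andP[xu xv]; apply: loS; rewrite ?E2; lra.
- move=> x xab; have [E1 E2 E3 E4] := shuffle_affine x d01.
  by move=> /upS[|xu]; rewrite ?E2 ?le_min; lra.
rewrite (@lebesgue_initial_segment _ (1 / 2)%R (1 - d)%R
  (Num.min u (v + (1 / 2 - d)))%R) //; last 2 first.
- move=> x xab; have [E1 E2 E3 E4] := shuffle_affine x d01.
  by rewrite lt_min => /andP[xu xv]; apply: loS; rewrite ?E3; lra.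
- move=> x xab; have [E1 E2 E3 E4] := shuffle_affine x d01.
  by move=> /upS[|xu]; rewrite ?E3 ?le_min; lra.
rewrite (@lebesgue_initial_segment _ (1 - d)%R 1%R (Num.min u v)) //; last 2 first.
- move=> x xab; have [E1 E2 E3 E4] := shuffle_affine x d01.
  by rewrite lt_min => /andP[xu xv]; apply: loS; rewrite ?E4; lra.
- move=> x xab; have [E1 E2 E3 E4] := shuffle_affine x d01.
  by move=> /upS[|xu]; rewrite ?E4 ?le_min; lra.
by rewrite /upper_cop -clamp_sum // /clamp -!EFinD addrA.
Qed.

End Shuffle.

(** * Probability laws carried by graphs *)

Section CdfExistence.
Context {R : realType}.
Implicit Types d u v x : R.
Let U : probability _ R := uniform_prob (@ltr01 R).

(** The measure is the image of the uniform law under [x |-> (x, f x)]. *)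
Lemma graph_distribution (f : R -> R) : measurable_fun setT f ->
  exists P : probability (R * R)%type R,
    forall A, P A = U [set x | A (x, f x)].
Proof.
move=> mf.
have mg : @measurable_fun _ _ (measurableTypeR R) (R * R)%type setT
    (fun x => (x, f x)).
  by apply: measurable_fun_pair => //; exact: measurable_id.
pose X : {RV U >-> (R * R)%type} :=
  @mfun_Sub _ _ (measurableTypeR R) (R * R)%type _ (mem_set mg).
by exists (distribution U X).
Qed.

Lemma measurable_graph_rectangle (f : R -> R) u v : measurable_fun setT f ->
  measurable [set x : R | (`[0, u] `*` `[0, v]) (x, f x)].
Proof.
move=> mf; apply: measurableI; first exact: measurable_itv.
by rewrite -[X in measurable X]setTI; apply: mf => //; exact: measurable_itv.
Qed.

Lemma upper_cop_cdf d : 0 <= d <= 1 / 2 -> exists P, has_cdf (upper_cop d) P.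
Proof.
move=> d01; have [P PE] := graph_distribution (measurable_shuffle d).
exists P => u v; rewrite !in_itv /= => u01 v01; rewrite PE.
apply: shuffle_length => //.
- by apply: measurable_graph_rectangle; exact: measurable_shuffle.
- move=> x x01 xu xv; have := shuffle01 d01 x01.
  by split; rewrite /= in_itv /=; lra.
- by move=> x _ [] /=; rewrite !in_itv /= => /andP[_ ->] /andP[_ ->].
Qed.

(* The lower copula is the upper one for [1 / 2 - d] reflected by
   [v |-> 1 - v]. *)
Lemma lower_cop_cdf d : 0 <= d <= 1 / 2 -> exists P, has_cdf (lower_cop d) P.
Proof.
move=> d01; have e01 : 0 <= 1 / 2 - d <= 1 / 2 by lra.
set e := 1 / 2 - d in e01 *.
have mf : measurable_fun setT (fun x => 1 - shuffle e x).
  by apply: measurable_funB => //; exact: measurable_shuffle.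
have [P PE] := graph_distribution mf.
exists P => u v; rewrite !in_itv /= => u01 v01; rewrite PE.
(* Strictness in [B] makes its complement in [A] the closed condition [1 - shuffle e x <= v]. *)
pose A := [set x : R | x <= u]; pose B := A `&` [set x | shuffle e x < 1 - v].
have mA : measurable A.
  by rewrite /A -set_itvNyc; exact: measurable_itv.
have mB : measurable B.
  apply: measurableI => //; rewrite -[X in measurable X]setTI.
  rewrite [X in _ `&` X](_ : _ = shuffle e @^-1` `]-oo, 1 - v[); last first.
    by apply/seteqP; split=> x /=; rewrite in_itv.
  by apply: measurable_shuffle => //; exact: measurable_itv.
have UA : U A = u%:E.
  rewrite [LHS]uniform01E // (@lebesgue_initial_segment _ 0%R 1%R u) //;
    last by move=> x _ /ltW.
  by congr EFin; rewrite subr0 min_r ?max_r //; lra.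
have UB : U B = (upper_cop e u (1 - v))%:E.
  apply: shuffle_length => //; first by lra.
  - by move=> x _ xu xv; split=> //; exact: ltW.
  - by move=> x _ [xu /ltW].
rewrite -lower_upper_cop // -/e.
transitivity (U (A `\` B)).
  rewrite [LHS]uniform01E ?[RHS]uniform01E; last 2 first.
  - exact: measurableD.
  - exact: measurable_graph_rectangle.
  congr (lebesgue_measure _); apply/seteqP; split=> x [] /=; rewrite !in_itv /=.
    move=> [/andP[_ xu] /andP[_ xv]] x01; split=> //; split=> // -[_ /=]; lra.
  move=> [Ax nB] x01; have xu : x <= u by []; split=> //; have := shuffle01 e01 x01.
  have : 1 - v <= shuffle e x by rewrite leNgt; apply/negP => xv; exact: nB.
  by split; lra.
by apply: measureDS_fin => // x [].
Qed.

Lemma upper_cop_copula d : 0 <= d <= 1 / 2 -> is_copula (upper_cop d).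
Proof.
move=> d01; have [P cdfP] := upper_cop_cdf d01; apply: (cdf_copula cdfP) => u.
by rewrite in_itv /= /upper_cop => u01; split; minmax_lra.
Qed.

Lemma lower_cop_copula d : 0 <= d <= 1 / 2 -> is_copula (lower_cop d).
Proof.
move=> d01; have [P cdfP] := lower_cop_cdf d01; apply: (cdf_copula cdfP) => u.
by rewrite in_itv /= /lower_cop => u01; split; minmax_lra.
Qed.

End CdfExistence.

(** * The footrule of the extremal copulas *)

Section BlomqvistClass.
Context {R : realType}.
Implicit Types t d u v : R.

Lemma beta_classP t (C : R -> R -> R) :
  beta_class t C <-> is_copula C /\ C (1 / 2) (1 / 2) = (1 + t) / 4.
Proof.
split=> -[copC]; rewrite /blomqvist_beta => h; split=> //; first by lra.
by rewrite /blomqvist_beta h; lra.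
Qed.

Lemma beta_class_lower t : -1 <= t <= 1 -> beta_class t (lower_cop ((1 + t) / 4)).
Proof.
move=> t11; apply/beta_classP; split; first by apply: lower_cop_copula; lra.
by rewrite /lower_cop; minmax_lra.
Qed.

Lemma beta_class_upper t : -1 <= t <= 1 -> beta_class t (upper_cop ((1 + t) / 4)).
Proof.
move=> t11; apply/beta_classP; split; first by apply: upper_cop_copula; lra.
by rewrite /upper_cop; minmax_lra.
Qed.

(** The infimum is a minimum: the bound of [copula_between] is itself a copula of the class. *)
Lemma lowerBE t u v : -1 <= t <= 1 -> 0 <= u <= 1 -> 0 <= v <= 1 ->
  lowerB t u v = lower_cop ((1 + t) / 4) u v.
Proof.
move=> t11 u01 v01.
have lbE : lbound [set C u v | C in beta_class t] (lower_cop ((1 + t) / 4) u v).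
  move=> _ [C /beta_classP[copC <-] <-].
  by have /andP[] := copula_between copC u01 v01.
have EE : [set C u v | C in beta_class t] (lower_cop ((1 + t) / 4) u v).
  by exists (lower_cop ((1 + t) / 4)) => //; exact: beta_class_lower.
apply/eqP; rewrite eq_le; apply/andP; split.
  by apply: ge_inf EE; exists (lower_cop ((1 + t) / 4) u v).
by apply: lb_le_inf lbE; exists (lower_cop ((1 + t) / 4) u v).
Qed.

Lemma upperBE t u v : -1 <= t <= 1 -> 0 <= u <= 1 -> 0 <= v <= 1 ->
  upperB t u v = upper_cop ((1 + t) / 4) u v.
Proof.
move=> t11 u01 v01.
have ubE : ubound [set C u v | C in beta_class t] (upper_cop ((1 + t) / 4) u v).
  move=> _ [C /beta_classP[copC <-] <-].
  by have /andP[] := copula_between copC u01 v01.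
have EE : [set C u v | C in beta_class t] (upper_cop ((1 + t) / 4) u v).
  by exists (upper_cop ((1 + t) / 4)) => //; exact: beta_class_upper.
apply/eqP; rewrite eq_le; apply/andP; split.
  by apply: ge_sup ubE; exists (upper_cop ((1 + t) / 4) u v).
by apply: ub_le_sup EE; exists (upper_cop ((1 + t) / 4) u v).
Qed.

(** The footrule sees [C] only through its measure, and [has_cdf] tests values on the unit square
    alone; equal sets of candidates give the same choice by [get]. This is needed because the
    extremal functions are identified only there. *)
Lemma eq_spearman_footrule (C C' : R -> R -> R) :
  (forall u v, 0 <= u <= 1 -> 0 <= v <= 1 -> C u v = C' u v) ->
  spearman_footrule C = spearman_footrule C'.
Proof.
move=> CC'; rewrite /spearman_footrule /concordance /copula_measure.
suff -> : [set P | has_cdf C P] = [set P | has_cdf C' P] by [].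
apply/seteqP; split=> P cdfP u v Iu Iv; rewrite cdfP //.
  by rewrite CC'.
by rewrite CC'.
Qed.

Lemma measurable_pospart (f : R -> R) : measurable_fun setT f ->
  measurable_fun setT (fun x => Num.max 0 (f x)).
Proof. by move=> mf; apply: (measurable_maxr (f := cst 0)). Qed.

Lemma footrule_lower_cop d : 0 <= d <= 1 / 2 ->
  spearman_footrule (lower_cop d) = 3 * d ^+ 2 - 1 / 2.
Proof.
move=> d01; have [P cdfP] := lower_cop_cdf d01.
rewrite /spearman_footrule (concordance_Mcop (lower_cop_copula d01) cdfP).
pose g r : R := 1 - 2 * r + lower_cop d r r.
have g0 r : 0 <= r <= 1 -> 0 <= g r.
  by move=> r01; rewrite /g /lower_cop; minmax_lra.
have mg : measurable_fun setT g.
  apply: measurable_funD.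
    by apply: measurable_funB => //; exact: measurable_funM.
  apply: measurable_maxr.
    apply: measurable_pospart; apply: measurable_funB => //.
    exact: measurable_funD.
  by apply: measurable_funB; [apply: measurable_funB => //|];
    apply: measurable_pospart; exact: measurable_funB.
(* The diagonal of the lower copula is successively [0], [d - 1 + 2 r], [d] and [2 r - 1]. *)
have gE1 r : 0 <= r <= (1 - d) / 2 -> g r = - 2 * r + 1.
  by move=> h; rewrite /g /lower_cop; minmax_lra.
have gE2 r : (1 - d) / 2 <= r <= 1 / 2 -> g r = 0 * r + d.
  by move=> h; rewrite /g /lower_cop; minmax_lra.
have gE3 r : 1 / 2 <= r <= (1 + d) / 2 -> g r = - 2 * r + (1 + d).
  by move=> h; rewrite /g /lower_cop; minmax_lra.
have gE4 r : (1 + d) / 2 <= r <= 1 -> g r = 0 * r + 0.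
  by move=> h; rewrite /g /lower_cop; minmax_lra.
have [b1 b2] : (0 : R) <= (1 - d) / 2 /\ (1 - d) / 2 <= 1 / 2 by split; lra.
have [b3 b4] : 1 / 2 <= (1 + d) / 2 /\ (1 + d) / 2 <= 1 by split; lra.
have [h0 h1] : (0 : R) <= 1 / 2 /\ (1 / 2 : R) <= 1 by split; lra.
have g0l r : 0 <= r <= 1 / 2 -> 0 <= g r by move=> ?; apply: g0; lra.
have g0r r : 1 / 2 <= r <= 1 -> 0 <= g r by move=> ?; apply: g0; lra.
rewrite -/g /Rintegral (ge0_integral_cut mg g0 h0 h1).
rewrite (ge0_integral_cut mg g0l b1 b2) (ge0_integral_cut mg g0r b3 b4).
rewrite (integral_affine b1 gE1) (integral_affine b2 gE2).
rewrite (integral_affine b3 gE3) (integral_affine b4 gE4).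
by rewrite -!EFinD /=; lra.
Qed.

Lemma footrule_upper_cop d : 0 <= d <= 1 / 2 ->
  spearman_footrule (upper_cop d) = 6 * d - 6 * d ^+ 2 - 1 / 2.
Proof.
move=> d01; have [P cdfP] := upper_cop_cdf d01.
rewrite /spearman_footrule (concordance_Mcop (upper_cop_copula d01) cdfP).
pose g r : R := 1 - 2 * r + upper_cop d r r.
have g0 r : 0 <= r <= 1 -> 0 <= g r.
  by move=> r01; rewrite /g /upper_cop; minmax_lra.
have mg : measurable_fun setT g.
  apply: measurable_funD.
    by apply: measurable_funB => //; exact: measurable_funM.
  apply: measurable_minr; first exact: measurable_minr.
  by apply: measurable_funD; [apply: measurable_funD => //|];
    apply: measurable_pospart; exact: measurable_funB.
(* The diagonal of the upper copula is successively [r], [d], [d - 1 + 2 r] and [r]. *)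
have gE1 r : 0 <= r <= d -> g r = - 1 * r + 1.
  by move=> h; rewrite /g /upper_cop; minmax_lra.
have gE2 r : d <= r <= 1 / 2 -> g r = - 2 * r + (1 + d).
  by move=> h; rewrite /g /upper_cop; minmax_lra.
have gE3 r : 1 / 2 <= r <= 1 - d -> g r = 0 * r + d.
  by move=> h; rewrite /g /upper_cop; minmax_lra.
have gE4 r : 1 - d <= r <= 1 -> g r = - 1 * r + 1.
  by move=> h; rewrite /g /upper_cop; minmax_lra.
have [b1 b2] := andP d01.
have [b3 b4] : 1 / 2 <= 1 - d /\ 1 - d <= 1 by split; lra.
have [h0 h1] : (0 : R) <= 1 / 2 /\ (1 / 2 : R) <= 1 by split; lra.
have g0l r : 0 <= r <= 1 / 2 -> 0 <= g r by move=> ?; apply: g0; lra.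
have g0r r : 1 / 2 <= r <= 1 -> 0 <= g r by move=> ?; apply: g0; lra.
rewrite -/g /Rintegral (ge0_integral_cut mg g0 h0 h1).
rewrite (ge0_integral_cut mg g0l b1 b2) (ge0_integral_cut mg g0r b3 b4).
rewrite (integral_affine b1 gE1) (integral_affine b2 gE2).
rewrite (integral_affine b3 gE3) (integral_affine b4 gE4).
by rewrite -!EFinD /=; lra.
Qed.

End BlomqvistClass.

Theorem theorem7 (R : realType) (t : R) (ht : -1 <= t <= 1) :
  spearman_footrule (lowerB t) = 3 * (1 + t) ^+ 2 / 16 - 1 / 2 /\
  spearman_footrule (upperB t) = 1 - 3 * (1 - t) ^+ 2 / 8.
Proof.
have d01 : 0 <= (1 + t) / 4 <= 1 / 2 by lra.
rewrite (eq_spearman_footrule (fun u v => lowerBE ht)).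
rewrite (eq_spearman_footrule (fun u v => upperBE ht)).
(* With [d = (1 + t) / 4], the second value is [1 - 6 (1 / 2 - d)^2], where
   [1 / 2 - d = (1 - t) / 4]. *)
rewrite footrule_lower_cop // footrule_upper_cop //; split; lra.
Qed.
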